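(* Let $U(X)=\sum_{n\ge 0}u_nX^n\in\mathbb{F}_2[[X]]$ be the compositional inverse of the generating function $D(X)=\sum_{n\ge 0}d_nX^n\in\mathbb{F}_2[[X]]$ of the period-doubling sequence. Then the sequence $\boldsymbol{u}=(u_n)_{n\ge 0}$ is $2$-automatic.
   Context: The period-doubling sequence $(d_n)_{n\ge 0}$ is defined by $d_n=\nu_2(n+1)\bmod 2\in\{0,1\}$, where $\nu_2(m)$ is the exponent of the highest power of $2$ dividing $m$. The compositional inverse $U(X)$ is the series in $\mathbb{F}_2[[X]]$ with zero constant term such that $D(U(X))=X=U(D(X))$; it exists since $d_0=0$ and $d_1=1$. A deterministic finite automaton with output (DFAO) is a $6$-tuple $(Q,q_0,A,\delta,B,\mu)$ with $Q$ a finite set of states, $q_0\in Q$ the initial state, $A$ a finite input alphabet, $\delta:Q\times A\to Q$ the transition function (extended to words), $B$ a finite output alphabet and $\mu:Q\to B$ the output function. A sequence $(w_n)_{n\ge 0}$ is $k$-automatic ($k\ge 2$) if there exists a DFAO with input alphabet $\{0,1,\ldots,k-1\}$ such that $w_n=\mu(\delta(q_0,\mathrm{rep}_k(n)))$ for all $n\ge 0$, where $\mathrm{rep}_k(n)$ is the base-$k$ representation of $n$ (without leading zeros, the representation of $0$ being the empty word). *)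

(* Defs.v *)
From HB Require Import structures.
From mathcomp Require Import all_boot all_order all_algebra.

Set Implicit Arguments.
Unset Strict Implicit.
Unset Printing Implicit Defensive.

Import GRing.Theory.

Section FormalPowerSeries.
Local Open Scope ring_scope.
Variable R : comNzRingType.

(* R[[X]]: [a : fps] is the series \sum_(n >= 0) a n X^n.  Series are compared
   coefficientwise, with [=1]. *)
Definition fps := nat -> R.

Definition fps_one : fps := fun n => (n == 0%N)%:R.

Definition fps_X : fps := fun n => (n == 1%N)%:R.

Definition fps_mul (a b : fps) : fps :=
  fun n => \sum_(i < n.+1) a i * b (n - i)%N.

Definition fps_exp (a : fps) (k : nat) : fps := iter k (fps_mul a) fps_one.

(* a(b(X)), for b with zero constant term: then b^k has no term of degree less
   than k, so the coefficient of X^n in \sum_k (a k) b^k only involves the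
   indices k <= n.  Not meaningful if b 0 != 0. *)
Definition fps_comp (a b : fps) : fps :=
  fun n => \sum_(k < n.+1) a k * fps_exp b k n.

(* The condition on [a 0] makes [fps_comp b a] meaningful. *)
Definition is_compositional_inverse (a b : fps) : Prop :=
  [/\ a 0%N = 0, b 0%N = 0, fps_comp a b =1 fps_X & fps_comp b a =1 fps_X].

End FormalPowerSeries.

Definition period_doubling (n : nat) : nat := logn 2 n.+1 %% 2.

Definition period_doubling_fps : fps 'F_2 :=
  fun n => ((period_doubling n)%:R)%R.

Record dfao (A B : finType) := Dfao {
  dfao_state : finType;
  dfao_init : dfao_state;
  dfao_trans : dfao_state -> A -> dfao_state;
  dfao_out : dfao_state -> B
}.

Definition dfao_run (A B : finType) (M : dfao A B) (s : seq A) : B :=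
  dfao_out (foldl (@dfao_trans _ _ M) (dfao_init M) s).

Section Automatic.
Variables (k : nat) (k_gt1 : 1 < k).

Definition last_digit (n : nat) : 'I_k := Ordinal (ltn_pmod n (ltnW k_gt1)).

(* Any [fuel >= n] yields the complete expansion of n, since n %/ k < n for
   n > 0. *)
Fixpoint rep_rec (fuel n : nat) : seq 'I_k :=
  if fuel is fuel'.+1 then
    if n == 0 then [::] else rcons (rep_rec fuel' (n %/ k)) (last_digit n)
  else [::].

(* Base-k representation, most significant digit first, without leading zeros;
   [rep 0] is the empty word. *)
Definition rep (n : nat) : seq 'I_k := rep_rec n n.

Definition automatic (B : finType) (w : nat -> B) : Prop :=
  exists M : dfao 'I_k B, forall n, w n = dfao_run M (rep n).

End Automatic.

(* Main.v *)
Require Import Defs.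
From mathcomp Require Import all_boot all_order all_algebra.
From mathcomp Require Import ring.

Set Implicit Arguments.
Unset Strict Implicit.
Unset Printing Implicit Defensive.

Import GRing.Theory.

(** Splitting D by the parity of the exponent, d_(2n) = 0 and
    d_(2n+1) = 1 + d_n, and using D(X^2) = D^2 over F_2, gives
<<
        (1 + X^2) D = X + X (1 + X^2) D^2.
>>
    Substituting U for X, and X for D(U), gives a cubic equation E = 0 for U,
    with E = U + X + X U^2 + X^2 U + X^2 U^3.  The multiple (1 + X U) E of E has
    only additive terms left:
<<
        U = X + X^3 U^2 + X^3 U^4 = X + X^3 U(X^2) + X^3 U(X^4),
>>
    which [inverse_additive] states.  Reading off coefficients yields u_(2n) = 0,
    u_(4n+3) = u_n, u_1 = 1 and u_(4n+1) = u_(2n-1) for n > 0 ([inverse_even],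
    [inverse_1mod4], [inverse_3mod4]).

    These rules close up on four sequences: u_n, u_(2n+1), u_(2n-1) and u_(n-1),
    where the last two take the value 1 at n = 0.  The values of the four at
    2n + d are determined by d and their values at n, so the vector of values,
    an element of F_2^4, can serve as the state of an automaton reading the
    binary digits of n, most significant first ([automatic_of_step]).

    An identity between series is proved here as a family of divisibilities by
    X^N between polynomial truncations, so that composition is that of
    polynomials, a ring morphism. *)

(** * Power series modulo X^N *)

Section Truncation.
Local Open Scope ring_scope.

Lemma dvdXnP (F : fieldType) (N : nat) (p : {poly F}) :
  reflect (forall n, (n < N)%N -> p`_n = 0) ('X^N %| p).
Proof.
rewrite /dvdp -Pdiv.IdomainMonic.take_poly_modp.
apply: (iffP eqP) => [p0 n nN|p0].
  have /(congr1 (fun q : {poly F} => q`_n)) := p0.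
  by rewrite coef_take_poly nN coef0.
by apply/polyP=> n; rewrite coef_take_poly coef0; case: ltnP => // /p0.
Qed.

Definition fps_trunc (R : comNzRingType) (N : nat) (a : fps R) : {poly R} :=
  \poly_(i < N) a i.

Lemma coef_fps_trunc (R : comNzRingType) (N : nat) (a : fps R) (n : nat) :
  (fps_trunc N a)`_n = if (n < N)%N then a n else 0.
Proof. exact: coef_poly. Qed.

Lemma coef_fps_exp (R : comNzRingType) (b : fps R) (N k n : nat) : (n < N)%N ->
  fps_exp b k n = (fps_trunc N b ^+ k)`_n.
Proof.
elim: k n => [|k IHk] n nN; first by rewrite expr0 coef1.
rewrite exprS coefM.
transitivity (\sum_(i < n.+1) b i * fps_exp b k (n - i)%N) => //.
apply: eq_bigr => i _.
rewrite IHk ?(leq_ltn_trans (leq_subr _ _)) // coef_fps_trunc.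
by rewrite (leq_ltn_trans _ nN) // -ltnS.
Qed.

Lemma dvdXn_trunc_exp (F : fieldType) (b : fps F) (N k : nat) :
  b 0%N = 0 -> 'X^k %| fps_trunc N b ^+ k.
Proof.
move=> b0; rewrite dvdp_exp2r // -['X]expr1; apply/dvdXnP => -[|//] _.
by rewrite coef_fps_trunc b0 if_same.
Qed.

(** The series a and b may be cut at different orders M and N: the powers of b
    beyond the n-th do not contribute to the n-th coefficient. *)
Lemma coef_fps_comp (F : fieldType) (a b : fps F) (M N n : nat) :
    b 0%N = 0 -> (n < M)%N -> (n < N)%N ->
  fps_comp a b n = (fps_trunc M a \Po fps_trunc N b)`_n.
Proof.
move=> b0 nM nN; rewrite [fps_trunc M a]poly_def raddf_sum coef_sum /fps_comp.
rewrite (big_ord_widen M (fun k => a k * fps_exp b k n)) // big_mkcond.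
apply: eq_bigr => k _ /=.
rewrite comp_polyZ comp_Xn_poly coefZ -coef_fps_exp // ltnS.
case: leqP => // nk; rewrite (coef_fps_exp _ _ nN).
by have /dvdXnP -> := dvdXn_trunc_exp N k b0; rewrite ?mulr0.
Qed.

End Truncation.

(** * Polynomials over F_2 *)

Section Characteristic2.
Local Open Scope ring_scope.

Lemma poly_F2_two : (2%:R : {poly 'F_2}) = 0.
Proof.
by rewrite -[2%:R]polyC_natr (_ : 2%:R = 0) ?polyC0 //; apply: val_inj.
Qed.

Lemma F2_sqr (c : 'F_2) : c ^+ 2 = c.
Proof. by case: c => -[|[|//]] ?; apply: val_inj. Qed.

(** Squaring is additive and fixes the coefficients, so it only acts on X. *)
Lemma sqr_poly_F2 (p : {poly 'F_2}) : p ^+ 2 = p \Po 'X^2.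
Proof.
elim/poly_ind: p => [|p c IHp]; first by rewrite comp_poly0 expr0n.
rewrite comp_polyD comp_polyM comp_polyX comp_polyC -IHp sqrrD -mulr_natr.
by rewrite poly_F2_two mulr0 addr0 exprMn -polyC_exp F2_sqr.
Qed.

End Characteristic2.

(** * The functional equation of the period-doubling series *)

Section PeriodDoubling.
Local Open Scope ring_scope.

Lemma period_doubling_even (n : nat) : period_doubling_fps n.*2 = 0.
Proof.
rewrite /period_doubling_fps /period_doubling logn_coprime //.
by rewrite coprime2n /= odd_double.
Qed.

Lemma period_doubling_odd (n : nat) :
  period_doubling_fps n.*2.+1 = 1 + period_doubling_fps n.
Proof.
rewrite /period_doubling_fps /period_doubling -doubleS -mul2n lognM //.
rewrite (_ : logn 2 2 = 1)%N // !modn2 add1n /=.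
by case: odd; apply: val_inj.
Qed.

(** Truncation at order 2M on the left and M on the right makes the parity
    splitting exact: the terms of degree below 2M come from the d_k with k < M.
    The geometric sum of the X^(2k) contributes the factor X^(2M) - 1 instead of
    -1. *)
Lemma period_doubling_poly_eq (M : nat) :
  let D m := fps_trunc m period_doubling_fps in
  ('X^2 - 1) * D M.*2 = 'X * ('X^2 ^+ M - 1 + ('X^2 - 1) * D M ^+ 2).
Proof.
move=> D; rewrite ['X^2 ^+ M - 1]subrX1 -mulrDr mulrCA; congr (_ * _).
have -> : \sum_(i < M) ('X^2) ^+ i + D M ^+ 2
          = (\poly_(i < M) (1 + period_doubling_fps i)) \Po 'X^2.
  rewrite [D M ^+ 2]sqr_poly_F2 /D /fps_trunc !poly_def !raddf_sum -big_split /=.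
  apply: eq_bigr => i _.
  by rewrite !comp_polyZ comp_Xn_poly scalerDl scale1r.
apply/polyP => n; rewrite coefXM coef_fps_trunc.
case: n => [|n]; first by rewrite (period_doubling_even 0) if_same.
rewrite coef_comp_poly_Xn //= coef_poly.
rewrite -[n]odd_double_half; case: (odd n) => /=.
  rewrite add1n -doubleS period_doubling_even if_same.
  by rewrite dvdn2 /= odd_double.
rewrite add0n period_doubling_odd dvdn2 odd_double /= divn2 doubleK.
by rewrite ltn_Sdouble.
Qed.

End PeriodDoubling.

(** * The compositional inverse *)

Section Inverse.
Local Open Scope ring_scope.

(** The elimination that turns the cubic equation into an additive one, modulo
    q.  Here p stands for U, and a q + x, b q + x and c q are the values, known
    modulo q, that take the place of D(U) (twice) and of U^(2N) in the equation
    of D. *)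
Lemma cubic_to_additive (R : comNzRingType) (x p q a b c : R) :
    2%:R = 0 :> R ->
    (p ^+ 2 - 1) * (b * q + x)
      = p * (c * q - 1 + (p ^+ 2 - 1) * (a * q + x) ^+ 2) ->
  exists w, p - (x + x ^+ 3 * p ^+ 2 + x ^+ 3 * (p ^+ 2) ^+ 2) = w * q.
Proof.
move=> two0 /eqP; rewrite -subr_eq0 => /eqP E.
(* The cofactor collects the multiples of q left after multiplication of the
   hypothesis by 1 + x p. *)
exists ((1 + x * p) * (p * (c + (p ^+ 2 - 1) * (a ^+ 2 * q + 2%:R * a * x))
         - (p ^+ 2 - 1) * b)).
apply/eqP; rewrite -subr_eq0; apply/eqP.
transitivity ((1 + x * p) * ((p ^+ 2 - 1) * (b * q + x)
      - p * (c * q - 1 + (p ^+ 2 - 1) * (a * q + x) ^+ 2))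
    - 2%:R * (x * p ^+ 2 + x ^+ 3 * p ^+ 2)); first by ring.
by rewrite E two0 mulr0 mul0r subr0.
Qed.

(** The equation U = X + X^3 U^2 + X^3 U^4 is the useful form of the algebraic
    equation of U, since U^2 and U^4 are merely U(X^2) and U(X^4): it is linear
    in the coefficients of U. *)
Lemma inverse_additive (u : fps 'F_2) (N : nat) :
    is_compositional_inverse period_doubling_fps u ->
  'X^N %| fps_trunc N u
    - ('X + 'X^3 * fps_trunc N u ^+ 2 + 'X^3 * (fps_trunc N u ^+ 2) ^+ 2).
Proof.
case=> _ u0 Du _; set P := fps_trunc N u.
pose D m := fps_trunc m period_doubling_fps.
have DP M : (N <= M)%N -> 'X^N %| D M \Po P - 'X.
  move=> NM; apply/dvdXnP => n nN.
  by rewrite coefB -coef_fps_comp ?(leq_trans nN) // Du coefX subrr.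
have /dvdpP [a /(canRL (subrK _)) Da] := DP _ (leqnn N).
have NN : (N <= N.*2)%N by rewrite -addnn leq_addr.
have /dvdpP [b /(canRL (subrK _)) Db] := DP _ NN.
have /dvdpP [c Pc] : 'X^N %| (P ^+ 2) ^+ N.
  by rewrite exprAC expr2 dvdp_mull // dvdXn_trunc_exp.
have := congr1 (comp_poly P) (period_doubling_poly_eq N).
rewrite -/(D N) -/(D N.*2).
have P1 : 1 \Po P = 1 by rewrite -polyC1 comp_polyC.
have PX k q : q ^+ k \Po P = (q \Po P) ^+ k by rewrite rmorphXn.
rewrite !(PX, comp_polyB, comp_polyD, P1, comp_polyX, comp_polyM).
rewrite Da Db Pc => E.
by apply/dvdpP; exact: cubic_to_additive poly_F2_two E.
Qed.

Lemma inverse_coef (u : fps 'F_2) (n : nat) :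
    is_compositional_inverse period_doubling_fps u ->
  u n = (n == 1%N)%:R
    + (if (n < 3)%N then 0 else
        (if (2 %| n - 3)%N then u ((n - 3) %/ 2)%N else 0)
      + (if (4 %| n - 3)%N then u ((n - 3) %/ 4)%N else 0)).
Proof.
move=> hu; have /dvdXnP /(_ n (ltnSn n)) := inverse_additive n.+1 hu.
rewrite [_ ^+ 2 ^+ 2]sqr_poly_F2 [fps_trunc _ _ ^+ 2]sqr_poly_F2.
rewrite -comp_polyA comp_Xn_poly -exprM => /eqP.
rewrite coefB subr_eq0 coef_fps_trunc ltnSn => /eqP ->.
rewrite !coefD coefX !coefXnM -addrA; congr (_ + _).
case: ltnP => n3; rewrite ?addr0 //.
have lt k : ((n - 3) %/ k < n.+1)%N.
  by rewrite ltnS (leq_trans (leq_div _ _)) ?leq_subr.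
by rewrite !coef_comp_poly_Xn // !coef_fps_trunc !lt.
Qed.

Lemma inverse_even (u : fps 'F_2) (n : nat) :
  is_compositional_inverse period_doubling_fps u -> u n.*2 = 0.
Proof.
move=> hu; rewrite (inverse_coef _ hu).
rewrite (_ : (n.*2 == 1)%N = false) ?add0r; last by case: n.
case: ltnP => // n3.
have odd_n3 : (2 %| n.*2 - 3)%N = false by rewrite dvdn2 oddB // odd_double.
rewrite odd_n3 (_ : (4 %| n.*2 - 3)%N = false) ?addr0 //.
by apply/negP => /(dvdn_trans (isT : 2 %| 4)%N); rewrite odd_n3.
Qed.

Lemma inverse_1mod4 (u : fps 'F_2) (n : nat) :
    is_compositional_inverse period_doubling_fps u ->
  u n.*2.*2.+1 = if n is m.+1 then u m.*2.+1 else 1.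
Proof.
move=> hu; rewrite (inverse_coef _ hu); case: n => [|m]; first by rewrite addr0.
rewrite (_ : m.+1.*2.*2.+1 - 3 = m.*2.+1.*2)%N; last first.
  by rewrite !doubleS !subSS subn0.
rewrite dvdn2 odd_double /= divn2 doubleK add0r.
rewrite (_ : (4 %| _)%N = false) ?addr0 //.
by rewrite -[4%N]/(2 * 2)%N -muln2 dvdn_pmul2r // dvdn2 /= odd_double.
Qed.

(** Both U(X^2) and U(X^4) contribute here, but the contribution u_(2n) of the
    former vanishes. *)
Lemma inverse_3mod4 (u : fps 'F_2) (n : nat) :
  is_compositional_inverse period_doubling_fps u -> u n.*2.*2.+3 = u n.
Proof.
move=> hu; rewrite (inverse_coef _ hu) /= add0r !subSS subn0.
rewrite dvdn2 odd_double /= divn2 doubleK (inverse_even _ hu) add0r.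
by rewrite -!muln2 -mulnA dvdn_mull // mulnK.
Qed.

End Inverse.

(** * The automaton *)

(** Reading a digit d after the expansion of n leads to the expansion of
    n k + d, so an automaton that starts in f 0 and moves by [step] is in state
    f n once it has read n. *)
Lemma automatic_of_step (k : nat) (k_gt1 : 1 < k) (Q B : finType)
    (f : nat -> Q) (step : Q -> 'I_k -> Q) (out : Q -> B) :
    (forall n (d : 'I_k), f (n * k + d) = step (f n) d) ->
  automatic k_gt1 (out \o f).
Proof.
move=> f_step; exists (Dfao (f 0) step out) => n; congr out.
rewrite /dfao_run /rep /=.
(* The fuel has to vary independently of n, as any bound on n. *)
have: n <= n by []; move: {2 4}n => m.
elim: m n => [|m IHm] n /=; first by rewrite leqn0 => /eqP ->.
case: eqP => [-> //|/eqP]; rewrite -lt0n => n_gt0 nm.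
rewrite foldl_rcons -IHm -?f_step -?divn_eq //.
by rewrite -ltnS (leq_trans (ltn_Pdiv _ _)).
Qed.

Theorem corollary12 (u : fps 'F_2)
    (hu : is_compositional_inverse period_doubling_fps u) :
  automatic (isT : 1 < 2) u.
Proof.
(* The sequences u_(2n-1) and u_(n-1).  The value 1 at n = 0 is the one that
   u_(4n+1) = u_(2n-1) asks for, since u_1 = 1; the transition 0 at n = 0 then
   forces it on the other sequence. *)
pose v n := if n is m.+1 then u m.*2.+1 else 1%R.
pose w n := if n is m.+1 then u m else 1%R.
pose f n := (u n, u n.*2.+1, v n, w n).
pose step (q : 'F_2 * 'F_2 * 'F_2 * 'F_2) (d : 'I_2) :=
  let: (a, s, b, c) := q in
  if d == ord0 then (0%R, b, c, b) else (s, a, b, 0%R).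
have f_step n (d : 'I_2) : f (n * 2 + d) = step (f n) d.
  case: d => -[|[|//]] d2; rewrite /f /step /= muln2 ?addn0 ?addn1.
    rewrite (inverse_even _ hu) (inverse_1mod4 _ hu); congr (_, _, _, _).
    - by case: n => // n; rewrite doubleS /= (inverse_3mod4 _ hu).
    - by case: n.
  rewrite /v /w /= (inverse_even _ hu) (inverse_1mod4 _ hu).
  by rewrite doubleS (inverse_3mod4 _ hu).
exact: (automatic_of_step (isT : 1 < 2) (fun q => q.1.1.1) f_step).
Qed.
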